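(* Let $n$ be a positive integer. The map $f:\mathrm{NN}(A_{n-1})\to\mathrm{NC}(A_{n-1})$ defined recursively in the context coincides with the L-map (the map from nonnesting partitions of $[n]$ to noncrossing partitions of $[n]$ that locally converts each crossing to a nesting); that is, $f(\alpha)=L(\alpha)$ for every $\alpha\in\mathrm{NN}(A_{n-1})$.
   Context: **Roots.** Let $e_1,\dots,e_n$ be the standard basis of $\mathbb{R}^n$. The positive roots of type $A_{n-1}$ are $\Phi^+=\{e_i-e_j:1\le j<i\le n\}$, with simple roots $r_i=e_{i+1}-e_i$ ($1\le i\le n-1$); they are the sums $r_i+\cdots+r_j$ with $1\le i\le j\le n-1$, and such a root is identified with the transposition $(i\; j+1)\in\mathfrak{S}_n$. Its support is $\{r_i,\dots,r_j\}$, its first index is $i$ and its last index is $j$. Products of permutations are composed from right to left, and a permutation in $\mathfrak{S}_n$ is identified with the partition of $[n]=\{1,\dots,n\}$ into its cycles (fixed points being singleton blocks). **$\mathrm{NN}$ and $\mathrm{NC}$.** The root order on $\Phi^+$ is $\alpha\le\beta$ iff $\beta-\alpha$ is a nonnegative integer combination of simple roots. $\mathrm{NN}(A_{n-1})$ is the set of antichains of $(\Phi^+,\le)$. An antichain is identified with the partition of $[n]$ generated by putting $i$ and $j$ in the same block whenever $e_i-e_j$ is in the antichain; this identifies $\mathrm{NN}(A_{n-1})$ with the set of nonnesting partitions of $[n]$ (if $a<b<c<d$ and $a,d$ are consecutive elements of a block, then $b,c$ are not both in some other block). $\mathrm{NC}(A_{n-1})$ is the set of noncrossing partitions of $[n]$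 (no $a<b<c<d$ with $a,c$ in one block and $b,d$ in another). **The map $f$.** For positive roots $\alpha,\beta$ with intersecting supports, $\alpha\cup\beta$ and $\alpha\cap\beta$ denote the positive roots whose supports are the union and the intersection of the supports. Antichains are written as tuples $(\alpha_1,\dots,\alpha_m)$ ordered by strictly increasing last index. An antichain is connected if any two adjacent roots $\alpha_i,\alpha_{i+1}$ have intersecting supports; its connected components are its maximal connected runs of consecutive roots. Define $f$ recursively: $f$ of the empty antichain is the identity; $f(\alpha_1)=\alpha_1$ for a single root; for a connected antichain with $m\ge2$, $$f(\alpha_1,\dots,\alpha_m)=\left(\bigcup_{k=1}^m\alpha_k\right)f(\overline\alpha_2,\dots,\overline\alpha_m),\qquad \overline\alpha_k=\alpha_{k-1}\cap\alpha_k$$ (the sequence $(\overline\alpha_2,\dots,\overline\alpha_m)$ is again an antichain, not necessarily connected); for a general antichain, $f$ is the product of the values of $f$ on its connected components, in order. **The L-map.** Represent a partition of $[n]$ by arcs: an arc joins $i<j$ whenever $i,j$ are in the same block and no element strictly between them is in that block. Given a nonnesting partition, repeatedly choose two crossing arcs joining $a,c$ and $b,d$ with $a<b<c<d$ and replace them by the nested arcs joining $a,d$ and $b,c$, until no two arcs cross. The outcome does not depend on the choices and is the arc diagram of a noncrossing partition of $[n]$, which is the image $L(\alpha)$ of the given nonnesting partition $\alpha$. *)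

(* Defs.v *)
From mathcomp Require Import all_boot all_order all_algebra all_fingroup.

Set Implicit Arguments.
Unset Strict Implicit.
Unset Printing Implicit Defensive.

Import GRing.Theory.

(* All indices are shifted by one: the set [n] = {1, ..., n} is 'I_n, and the
   simple roots r_1, ..., r_(n-1) are indexed by 'I_n.-1. *)

(* The element (j, i), j < i, stands for the root e_i - e_j.  Under the
   identification with transpositions it is the transposition (j i). *)
Definition posroot (n : nat) := {p : 'I_n * 'I_n | p.1 < p.2}.

Section Roots.
Variable n : nat.
Implicit Types (a b r : posroot n) (A : {set posroot n}).

Definition lo r : 'I_n := (val r).1.
Definition hi r : 'I_n := (val r).2.

(* Roots have integer coordinates, so Z^n is used in place of R^n. *)
Definition stdvec (k : nat) : 'rV[int]_n := (\row_(j < n) (j == k :> nat)%:R)%R.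

Definition rootvec r : 'rV[int]_n := (stdvec (hi r) - stdvec (lo r))%R.

Definition simple_root (k : 'I_n.-1) : 'rV[int]_n := (stdvec k.+1 - stdvec k)%R.

Definition root_le a b : Prop :=
  exists c : 'I_n.-1 -> nat,
    (rootvec b - rootvec a = \sum_(k < n.-1) simple_root k *+ c k)%R.

Definition NN A : Prop := {in A &, forall a b, root_le a b -> a = b}.

Definition supp r : {set 'I_n.-1} := [set k : 'I_n.-1 | lo r <= k < hi r].

Lemma rootvec_supp r : rootvec r = (\sum_(k in supp r) simple_root k)%R.
Proof.
rewrite /rootvec; have lt_r : lo r < hi r := valP r.
have hi_n : hi r <= n.-1 by rewrite -ltnS (ltn_predK (ltn_ord (hi r))).
rewrite -(telescope_sumr _ (ltnW lt_r)) (big_nat_widen _ _ _ _ _ hi_n).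
rewrite (big_nat_widenl _ 0) // big_mkord.
by apply: eq_bigl => k; rewrite !inE /= andbC.
Qed.

Definition meets a b : bool := supp a :&: supp b != set0.

(* A root is determined by its support; the default a is returned only when S
   is not the support of a root. *)
Definition root_of_supp a (S : {set 'I_n.-1}) : posroot n :=
  odflt a [pick r | supp r == S].

Definition rcup a b : posroot n := root_of_supp a (supp a :|: supp b).
Definition rcap a b : posroot n := root_of_supp a (supp a :&: supp b).

Definition transp r : {perm 'I_n} := tperm (lo r) (hi r).

End Roots.

Section MapF.
Variable n : nat.
Local Notation root := (posroot n).
Implicit Types (a b : root) (s c : seq root) (A : {set root}).

(* Right-to-left composition; the product of {perm T} is left-to-right. *)
Definition pcomp (u v : {perm 'I_n}) : {perm 'I_n} := (v * u)%g.

Lemma pcompE u v x : pcomp u v x = u (v x).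
Proof. exact: permM. Qed.

Definition pprod (us : seq {perm 'I_n}) : {perm 'I_n} := foldr pcomp 1%g us.

Definition connected s : bool := sorted (@meets n) s.

Fixpoint components s : seq (seq root) :=
  if s is a :: s' then
    match components s' with
    | (b :: c) :: cs =>
        if meets a b then (a :: b :: c) :: cs else [:: a] :: (b :: c) :: cs
    | _ => [:: [:: a]]
    end
  else [::].

Definition overline s : seq root :=
  if s is a :: s' then pairmap (@rcap n) a s' else [::].

(* The first argument bounds the recursion depth; f_connected and
   f_components below are the intended recursive equations. *)
Fixpoint f_rec (k : nat) s : {perm 'I_n} :=
  if k is k'.+1 then
    pprod [seq match c with
               | [::] => 1%g
               | [:: a] => transp a
               | a :: c' => pcomp (transp (foldl (@rcup n) a c'))
                                  (f_rec k' (overline c))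
               end | c <- components s]
  else 1%g.

Definition f_seq s : {perm 'I_n} := f_rec (size s) s.

(* The last indices of the roots of an antichain are pairwise distinct, so
   they determine the order. *)
Definition f_map A : {perm 'I_n} :=
  f_seq (sort (fun a b => hi a <= hi b) (enum A)).

Lemma components_nil s : [::] \notin components s.
Proof.
elim: s => //= a s; case: (components s) => [|[|b c] cs] //=.
by case: ifP => _; rewrite !inE.
Qed.

Lemma components_flatten s : flatten (components s) = s.
Proof.
elim: s => //= a s; have := components_nil s.
case: (components s) => [|[|b c] cs] //= _ <- //.
by case: ifP.
Qed.

Lemma components_connected s : all connected (components s).
Proof.
elim: s => //= a s; case: (components s) => [|[|b c] cs] //=.
by case: ifP => [mab | _] //= /andP[pc pcs]; rewrite ?mab pc pcs.
Qed.

Lemma components_maximal s :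
  sorted (fun c d : seq root => if (c, d) is (a :: c', b :: _)
            then ~~ meets (last a c') b else false) (components s).
Proof.
elim: s => //= a s; case: (components s) => [|[|b c] cs] //=.
case: ifP => /= [_ | -> //].
by case: cs.
Qed.

Lemma components1 a s : connected (a :: s) -> components (a :: s) = [:: a :: s].
Proof.
elim: s a => [//|b s IH] a /andP[mab cs].
by rewrite [components _]/= -/(components (b :: s)) (IH b cs) mab.
Qed.

Lemma size_overline s : size (overline s) = (size s).-1.
Proof. by case: s => //= a s; rewrite size_pairmap. Qed.

Lemma size_component s c : c \in components s -> size c <= size s.
Proof.
move=> cs; rewrite -[in leqRHS](components_flatten s) size_flatten sumnE.
by rewrite big_map (big_rem c cs) leq_addr.
Qed.

Lemma f_rec_eq k m s : size s <= k -> size s <= m -> f_rec k s = f_rec m s.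
Proof.
elim: k m s => [|k IH] [|m] s; rewrite ?leqn0 //.
- by move=> /nilP->.
- by move=> _ /nilP->.
move=> sk sm /=; congr pprod; apply/eq_in_map => -[|a [|b c]] // cs.
congr pcomp; have sc := size_component cs.
apply: IH; rewrite size_overline -ltnS /=.
  exact: leq_trans sc sk.
exact: leq_trans sc sm.
Qed.

Lemma f_rec_seq k s : size s <= k -> f_rec k s = f_seq s.
Proof. by move=> sk; apply: f_rec_eq. Qed.

Lemma f_nil : f_seq [::] = 1%g.
Proof. by []. Qed.

Lemma f_single a : f_seq [:: a] = transp a.
Proof. by rewrite /f_seq /= /pprod /= /pcomp mul1g. Qed.

Lemma f_connected a b s : connected [:: a, b & s] ->
  f_seq [:: a, b & s] =
    pcomp (transp (foldl (@rcup n) a (b :: s))) (f_seq (overline [:: a, b & s])).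
Proof.
move=> cs; rewrite {1}/f_seq; set t := [:: a, b & s].
have -> : f_rec (size t) t = pprod [:: pcomp (transp (foldl (@rcup n) a (b :: s)))
                                        (f_rec (size s).+1 (overline t))].
  by rewrite [LHS]/(pprod [seq _ | c <- components t]) components1.
rewrite -[LHS]/(1 * _)%g mul1g (@f_rec_seq (size s).+1) //.
by rewrite size_overline.
Qed.

Lemma f_components s : f_seq s = pprod [seq f_seq c | c <- components s].
Proof.
rewrite {1}/f_seq; case Ds: (size s) => [|k]; first by rewrite (size0nil Ds).
congr pprod; apply/eq_in_map => c cs; have := size_component cs.
have := allP (components_connected s) _ cs.
case: c {cs} => [|a [|b c]] //; first by rewrite f_single.
move=> cc; rewrite Ds => sc; rewrite f_connected //; congr pcomp; apply: f_rec_seq.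
by rewrite size_overline.
Qed.

End MapF.

Section Partitions.
Variable n : nat.
Local Notation partn := {set {set 'I_n}}.
Local Notation diagram := {set 'I_n * 'I_n}.
Implicit Types (A : {set posroot n}) (P Q : partn) (D : diagram).

Definition root_edge A : rel 'I_n :=
  fun i j => [exists r in A, (i == lo r) && (j == hi r)
                          || (i == hi r) && (j == lo r)].

Definition NN_partition A : partn :=
  equivalence_partition (connect (root_edge A)) [set: 'I_n].

Definition NC P : Prop :=
  partition P [set: 'I_n] /\
  forall (B C : {set 'I_n}) (a b c d : 'I_n),
    B \in P -> C \in P -> a < b -> b < c -> c < d ->
    a \in B -> c \in B -> b \in C -> d \in C -> B = C.

Definition arcs P : diagram :=
  [set p : 'I_n * 'I_n | (p.1 < p.2) &&
    [exists B in P, [&& p.1 \in B, p.2 \in B &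
                        [forall k in B, ~~ (p.1 < k < p.2)]]]].

Definition crossing D (a b c d : 'I_n) : bool :=
  [&& a < b, b < c, c < d, (a, c) \in D & (b, d) \in D].

Definition uncross (D D' : diagram) : bool :=
  [exists a, exists b, exists c, exists d, crossing D a b c d &&
    (D' == [set (a, d); (b, c)] :|: (D :\: [set (a, c); (b, d)]))].

Definition crossing_free D : bool :=
  ~~ [exists a, exists b, exists c, exists d, crossing D a b c d].

Definition outcome (D D' : diagram) : bool :=
  connect uncross D D' && crossing_free D'.

(* Independence of the choices is part of the condition: the arc diagram of Q
   is the one and only outcome. *)
Definition is_L_image P Q : bool :=
  partition Q [set: 'I_n] &&
  [forall D : diagram, outcome (arcs P) D == (D == arcs Q)].

(* A partition is determined by its arcs, so at most one Q qualifies.  The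
   default set0 is not a partition of [n] for n > 0; hence if L_map P is a
   partition, it is the common outcome of all choices. *)
Definition L_map P : partn := odflt set0 [pick Q | is_L_image P Q].

End Partitions.

(* Main.v *)
From mathcomp Require Import all_boot all_fingroup all_algebra.
From mathcomp Require Import zify.
Require Import Defs.

(* The roots of a nonnesting antichain have distinct lower ends and distinct
   upper ends.  Each step of the recursion for f takes out the arc from the
   least lower end to the greatest upper end and rematches the remaining ends
   strictly inside it, so f is a product of transpositions over a noncrossing
   arc diagram with the same lower ends and the same upper ends.  Such arcs form
   a forest of increasing chains, hence the cycles of the product are the chains.
   Uncrossing two arcs also keeps the sets of lower and upper ends, and these
   determine a noncrossing diagram, as in the matching of parentheses. *)

Set Implicit Arguments.
Unset Strict Implicit.
Unset Printing Implicit Defensive.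

(** * Supports of roots as intervals *)

Section Roots.
Variable n : nat.
Implicit Types (a b c r : posroot n) (A : {set posroot n}).

Lemma lo_lt_hi r : lo r < hi r.
Proof. exact: (valP r). Qed.

Lemma root_lo_hi r : val r = (lo r, hi r).
Proof. by rewrite /lo /hi; case: (val r). Qed.

Lemma root_of_lt (i j : 'I_n) : i < j -> {r | lo r = i & hi r = j}.
Proof. by move=> ij; exists (exist _ (i, j) ij). Qed.

Lemma mem_supp r (k : 'I_n.-1) : (k \in supp r) = (lo r <= k < hi r).
Proof. by rewrite inE. Qed.

Lemma supp_subset a b :
  (supp a \subset supp b) = (lo b <= lo a) && (hi a <= hi b).
Proof.
have la := lo_lt_hi a; have ha := ltn_ord (hi a).
apply/subsetP/idP => [sab | ab k]; last by rewrite !mem_supp; lia.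
(* The inclusion is decided by the two extreme simple roots of [supp a], with indices [lo a] and
   [(hi a).-1]. *)
have lo_n : lo a < n.-1 by lia.
have hi_n : (hi a).-1 < n.-1 by lia.
have := sab (Ordinal lo_n); have := sab (Ordinal hi_n).
rewrite !mem_supp /=; lia.
Qed.

Lemma supp_inj : injective (@supp n).
Proof.
move=> a b Eab; apply: val_inj.
have : (supp a \subset supp b) && (supp b \subset supp a) by rewrite Eab subxx.
rewrite !supp_subset !root_lo_hi => ab.
by congr pair; apply: val_inj => /=; lia.
Qed.

Lemma meetsE a b : meets a b = (lo a < hi b) && (lo b < hi a).
Proof.
have la := lo_lt_hi a; have lb := lo_lt_hi b.
have ha := ltn_ord (hi a); have hb := ltn_ord (hi b).
apply/set0Pn/idP => [[k] | ab]; first by rewrite inE !mem_supp; lia.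
have m_n : maxn (lo a) (lo b) < n.-1 by lia.
by exists (Ordinal m_n); rewrite inE !mem_supp /=; lia.
Qed.

Lemma root_of_suppE a r : root_of_supp a (supp r) = r.
Proof.
rewrite /root_of_supp; case: pickP => [b /eqP/supp_inj //|/(_ r)].
by rewrite eqxx.
Qed.

(** The form that incomparability takes in an antichain: neither support contains the other, so both
    ends move the same way. Being transitive, it passes from neighbours of a sorted sequence to all
    pairs. *)
Definition shifted a b : bool := (lo a < lo b) && (hi a < hi b).

Lemma shifted_trans : transitive shifted.
Proof. by move=> b a c; rewrite /shifted; lia. Qed.

(** Supports that meet have an interval as their union, so [root_of_supp] finds a genuine root and
    does not return its default. *)
Lemma rcup_shifted a b : shifted a b -> meets a b ->
  lo (rcup a b) = lo a /\ hi (rcup a b) = hi b.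
Proof.
rewrite /shifted meetsE => ab mab; have lt_ab : lo a < hi b by lia.
have [r lr hr] := root_of_lt lt_ab.
suff -> : rcup a b = r by [].
rewrite -(root_of_suppE a r) /rcup; congr root_of_supp.
by apply/setP => k; rewrite inE !mem_supp lr hr; lia.
Qed.

Lemma rcap_shifted a b : shifted a b -> meets a b ->
  lo (rcap a b) = lo b /\ hi (rcap a b) = hi a.
Proof.
rewrite /shifted meetsE => ab /andP[_ mab].
have [r lr hr] := root_of_lt mab.
suff -> : rcap a b = r by [].
rewrite -(root_of_suppE a r) /rcap; congr root_of_supp.
by apply/setP => k; rewrite inE !mem_supp lr hr; lia.
Qed.

Lemma root_le_supp a b : supp a \subset supp b -> root_le a b.
Proof.
(* The coefficients form the indicator function of [supp b] minus [supp a]; under the inclusion the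
   subtraction of booleans is never truncated. *)
move=> sab; exists (fun k => (k \in supp b) - (k \in supp a)).
rewrite !rootvec_supp [in LHS](big_setID (supp a)) /= (setIidPr sab).
rewrite GRing.addrAC GRing.subrr GRing.add0r [LHS]big_mkcond /=.
apply: eq_bigr => k _; rewrite inE.
have := subsetP sab k.
by case: (k \in supp a); case: (k \in supp b) => //= /(_ isT).
Qed.

Lemma NN_shifted A a b : NN A -> a \in A -> b \in A -> a != b ->
  shifted a b || shifted b a.
Proof.
move=> hA Aa Ab; apply: contraR => nab.
have {nab} : (supp a \subset supp b) || (supp b \subset supp a).
  by rewrite !supp_subset; move: nab; rewrite /shifted; lia.
case/orP => /root_le_supp /hA => [/(_ Aa Ab)|/(_ Ab Aa)] -> //.
Qed.

End Roots.

(** * The recursion for f as a noncrossing rematching of ends *)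

Section FSeq.
Variable n : nat.
Local Notation root := (posroot n).
Implicit Types (a b r : root) (s c g : seq root).

Definition noncrossing g : Prop :=
  {in g &, forall p q, ~~ [&& lo p < lo q, lo q < hi p & hi p < hi q]}.

(* [u] is a product of transpositions over a noncrossing rematching of the
   lower ends of [s] with its upper ends. *)
Definition repairs s (u : {perm 'I_n}) : Prop :=
  exists g, [/\ u = pprod (map (@transp n) g), noncrossing g,
    perm_eq (map (@lo n) g) (map (@lo n) s)
    & perm_eq (map (@hi n) g) (map (@hi n) s)].

Lemma pprod_cat (us vs : seq {perm 'I_n}) :
  pprod (us ++ vs) = pcomp (pprod us) (pprod vs).
Proof.
elim: us => [|u us IH]; first by rewrite /pcomp /= mulg1.
by rewrite /= IH /pcomp mulgA.
Qed.

(** Rematching keeps the lower and the upper ends, so arcs over [s1] still finish no later than arcs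
    over [s2] begin, and the two groups cannot cross. *)
Lemma repairs_cat s1 s2 u1 u2 :
    {in s1 & s2, forall a b, hi a <= lo b} ->
  repairs s1 u1 -> repairs s2 u2 -> repairs (s1 ++ s2) (pcomp u1 u2).
Proof.
move=> sep [g1 [-> nc1 l1 h1]] [g2 [-> nc2 l2 h2]]; exists (g1 ++ g2).
split; rewrite ?map_cat ?pprod_cat ?perm_cat //.
have hlt: {in g1 & g2, forall p q, hi p <= lo q}.
  move=> p q gp gq; have := map_f (@hi n) gp; rewrite (perm_mem h1).
  case/mapP => a sa ->; have := map_f (@lo n) gq; rewrite (perm_mem l2).
  by case/mapP => b sb ->; exact: sep.
move=> p q; rewrite !mem_cat => /orP[gp|gp] /orP[gq|gq].
- exact: nc1.
- by have := hlt _ _ gp gq; lia.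
- by have := hlt _ _ gq gp; have := lo_lt_hi p; lia.
- exact: nc2.
Qed.

Lemma foldl_rcup a s : path (@shifted n) a s -> path (@meets n) a s ->
  lo (foldl (@rcup n) a s) = lo a /\ hi (foldl (@rcup n) a s) = hi (last a s).
Proof.
(* The accumulator [x] is the union so far: it ends where the last absorbed root [a] ends but may
   begin earlier, so the induction tracks both roots. *)
suff H x : lo x <= lo a -> hi x = hi a ->
    path (@shifted n) a s -> path (@meets n) a s ->
  lo (foldl (@rcup n) x s) = lo x /\ hi (foldl (@rcup n) x s) = hi (last a s).
  exact: H.
elim: s a x => [|b s IH] a x xa ha //= /andP[ab pb] /andP[mab mb].
have xb : shifted x b by move: ab; rewrite /shifted ha; lia.
have mxb : meets x b.
  by move: ab mab; rewrite /shifted !meetsE ha; have := lo_lt_hi b; lia.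
have [lc hc] := rcup_shifted xb mxb.
rewrite -lc; apply: IH => //; rewrite lc.
by move: xb; rewrite /shifted; lia.
Qed.

(** Each intersection joins the lower end of the later root to the upper end of the earlier one.
    Only the least lower end and the greatest upper end drop out, and these are the ends of the
    union. *)
Lemma overline_shifted a s : path (@shifted n) a s -> path (@meets n) a s ->
  [/\ map (@lo n) (pairmap (@rcap n) a s) = map (@lo n) s,
      map (@hi n) (pairmap (@rcap n) a s) = map (@hi n) (belast a s)
    & sorted (@shifted n) (pairmap (@rcap n) a s)].
Proof.
elim: s a => [|b s IH] a //= /andP[ab pb] /andP[mab mb].
have [lc hc] := rcap_shifted ab mab.
have [-> -> so] := IH b pb mb; rewrite lc hc; split=> //.
case: s pb mb so {IH} => [|d s] //= /andP[bd _] /andP[mbd _] ->.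
have [lc' hc'] := rcap_shifted bd mbd.
by rewrite andbT /shifted lc hc lc' hc'; move: ab bd; rewrite /shifted; lia.
Qed.

Lemma path_shifted a s b : path (@shifted n) a s -> b \in s -> shifted a b.
Proof. by move=> /(order_path_min (@shifted_trans n)) /allP; apply. Qed.

Lemma path_shifted_last a s b : path (@shifted n) a s -> b \in belast a s ->
  shifted b (last a s).
Proof.
elim: s a => [//|d s IH] a /= /andP[ad ps]; rewrite inE => /orP[/eqP->|].
  have := mem_last d s; rewrite inE => /orP[/eqP->//|/(path_shifted ps)].
  exact: shifted_trans.
exact: IH.
Qed.

(** The last root of [c] does not meet the first root of the next component and is shifted before
    it, so it ends no later than that root begins. Monotonicity of both ends along the sequence does
    the rest. *)
Lemma components_separated (cs : seq (seq root)) c :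
    sorted (fun c d : seq root => if (c, d) is (a :: c', b :: _)
            then ~~ meets (last a c') b else false) (c :: cs) ->
    sorted (@shifted n) (flatten (c :: cs)) ->
  {in c & flatten cs, forall a b, hi a <= lo b}.
Proof.
case: cs => [|[|b d] cs]; first by move=> _ _ a b _.
  by case: c.
case: c => [//|a c] /= /andP[nm _]; rewrite -cat_cons.
rewrite cat_path /= => /and3P[pa ab pb] x y xc yd.
have xl : hi x <= hi (last a c).
  move: xc; rewrite lastI mem_rcons inE => /orP[/eqP->//|].
  by move/(path_shifted_last pa); rewrite /shifted; lia.
have ly : lo b <= lo y.
  move: yd; rewrite inE => /orP[/eqP->//|].
  by move/(path_shifted pb); rewrite /shifted; lia.
move: nm ab; rewrite meetsE /shifted; have := lo_lt_hi b.
have := lo_lt_hi (last a c); lia.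
Qed.

Lemma f_seq_repairs s : sorted (@shifted n) s -> repairs s (f_seq s).
Proof.
have [k] := ubnP (size s); elim: k s => // k IH s lt_sk so_s.
have flat_s := components_flatten s.
have conn : {in components s, forall c, sorted (@shifted n) c ->
    repairs c (f_seq c)}.
  move=> c cs; have := allP (components_connected s) _ cs.
  have sz_c := leq_trans (size_component cs) lt_sk.
  case: c cs sz_c => [|a [|b c]] cs sz_c conn_c so_c.
  - by exists [::].
  - exists [:: a]; split; rewrite ?f_single //.
      by rewrite /pprod /= /pcomp mul1g.
    by move=> p q; rewrite !inE => /eqP-> /eqP->; lia.
  rewrite f_connected //; set t := overline _.
  have [lo_t hi_t so_t] := overline_shifted so_c conn_c.
  have [lo_o hi_o] := foldl_rcup so_c conn_c.
  have [|g [-> nc_g lo_g hi_g]] := IH t _ so_t.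
    by rewrite size_overline.
  set o := foldl _ _ _ in lo_o hi_o *.
  (* The ends left for [g] exclude the two outer ones, so all its arcs lie strictly inside [o],
     which therefore crosses none of them. *)
  have in_g p : p \in g -> (lo o < lo p) && (hi p < hi o).
    move=> gp; have := map_f (@lo n) gp; have := map_f (@hi n) gp.
    rewrite (perm_mem lo_g) (perm_mem hi_g) lo_t hi_t lo_o hi_o.
    case/mapP=> x xc -> /mapP[y yc ->].
    case/andP: (path_shifted_last so_c xc) => _ ->.
    by case/andP: (path_shifted so_c yc) => ->.
  exists (o :: g); split=> //.
  - move=> p q; rewrite !inE => /orP[/eqP->|gp] /orP[/eqP->|gq].
    + by lia.
    + by have := in_g _ gq; lia.
    + by have := in_g _ gp; lia.
    + exact: nc_g.
  - by rewrite !map_cons lo_o perm_cons -map_cons -lo_t.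
  - rewrite [in X in perm_eq _ X]lastI map_rcons map_cons hi_o.
    by rewrite perm_sym perm_rcons perm_cons perm_sym -hi_t.
(* The rematchings of the components are now concatenated in order. *)
rewrite f_components -[in X in repairs X _]flat_s.
have := components_maximal s; rewrite -flat_s in so_s.
elim: (components s) conn so_s {lt_sk flat_s} => [|c cs IHc] conn so_s mx.
  by exists [::].
have sep := components_separated mx so_s.
move: so_s; rewrite /= => /cat_sorted2[so_c so_cs].
apply: repairs_cat => //; first by apply: conn; rewrite ?mem_head.
apply: IHc => //; last by case: (cs) mx => //= ? ? /andP[].
by move=> d dcs; apply: conn; rewrite inE dcs orbT.
Qed.

End FSeq.

(** * Chains of arcs as blocks and as cycles *)

Section Chains.
Variable n : nat.
Implicit Types (r : posroot n) (A G : {set posroot n}) (x y z : 'I_n).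

Definition dedge A : rel 'I_n :=
  fun x y => [exists r in A, (x == lo r) && (y == hi r)].

Lemma dedgeP A x y :
  reflect (exists2 r, r \in A & x = lo r /\ y = hi r) (dedge A x y).
Proof.
apply: (iffP exists_inP) => [[r Ar /andP[/eqP xr /eqP yr]]|[r Ar [-> ->]]].
  by exists r.
by exists r => //; rewrite !eqxx.
Qed.

Lemma root_edgeE A x y : root_edge A x y = dedge A x y || dedge A y x.
Proof.
apply/exists_inP/orP => [[r Ar /orP[]]|].
- by case/andP=> /eqP xr /eqP yr; left; apply/dedgeP; exists r.
- by case/andP=> /eqP xr /eqP yr; right; apply/dedgeP; exists r.
- case=> /dedgeP[r Ar [-> ->]]; exists r => //; rewrite !eqxx //.
  by rewrite orbT.
Qed.

Lemma root_edge_sym A : connect_sym (root_edge A).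
Proof. by apply: sym_connect_sym => x y; rewrite !root_edgeE orbC. Qed.

Lemma root_edge_equiv A : equivalence_rel (connect (root_edge A)).
Proof.
by apply/equivalence_relP; split; [apply: connect0|apply/same_connect/root_edge_sym].
Qed.

Lemma connect_first (T : finType) (e : rel T) (x y : T) :
  connect e x y -> x = y \/ exists2 z, e x z & connect e z y.
Proof.
case/connectP=> -[|z p] /= => [_ ->|/andP[xz zp] Dy]; first by left.
by right; exists z => //; apply/connectP; exists p.
Qed.

Lemma connect_last (T : finType) (e : rel T) (x y : T) :
  connect e x y -> x = y \/ exists2 z, connect e x z & e z y.
Proof.
case/connectP=> p; case/lastP: p => [_ ->|p z]; first by left.
rewrite rcons_path last_rcons => /andP[xp pz] ->.
by right; exists (last x p) => //; apply/connectP; exists p.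
Qed.

Lemma connect_dedge_le A x y : connect (dedge A) x y -> x <= y.
Proof.
case/connectP=> p; elim: p x => [|z p IH] x /= => [_ -> //|/andP[]].
by case/dedgeP=> r _ [-> ->] /IH{}IH /IH; have := lo_lt_hi r; lia.
Qed.

(** Distinct lower ends give each point at most one successor, distinct upper ends at most one
    predecessor. A walk that changes direction thus retraces its last arc, and components are
    increasing chains. *)
Lemma connect_dedge A x y :
    {in A &, injective (@lo n)} -> {in A &, injective (@hi n)} ->
    connect (root_edge A) x y ->
  connect (dedge A) x y || connect (dedge A) y x.
Proof.
move=> lo_inj hi_inj /connectP[p]; elim: p x => [|z p IH] x /=.
  by move=> _ ->; rewrite connect0.
case/andP; rewrite root_edgeE => xz /IH{}IH /IH{IH}.
case/orP: xz => /[dup] xz /dedgeP[r Ar [xr zr]] /orP[zy|yz].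
- by rewrite (connect_trans (connect1 xz) zy).
(* The last arc of the chain into [z] has the same upper end as [r], so it is [r], and the chain
   from [y] already visits [x]. *)
- case/connect_last: yz => [->|[w yw /dedgeP[q Aq [wq zq]]]].
    by rewrite connect1.
  have Eqr: q = r by apply: hi_inj => //; rewrite -zq -zr.
  by rewrite xr -Eqr -wq yw orbT.
- case/connect_first: zy => [<-|[w /dedgeP[q Aq [wq zq]] wy]].
    by rewrite (connect1 xz) orbT.
  have Eqr: q = r by apply: lo_inj => //; rewrite -xr -wq.
  by rewrite zr -Eqr -zq wy.
- by rewrite (connect_trans yz (connect1 xz)) orbT.
Qed.

Lemma connect_next A x y :
    {in A &, injective (@lo n)} -> {in A &, injective (@hi n)} ->
    connect (root_edge A) x y -> x < y ->
  exists r, [/\ r \in A, lo r = x, hi r <= y & connect (root_edge A) (hi r) y].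
Proof.
move=> lo_inj hi_inj /(connect_dedge lo_inj hi_inj)/orP[xy|yx] lt_xy.
  case/connect_first: xy => [Exy|[z /dedgeP[r Ar [xr zr]] zy]].
    by rewrite Exy ltnn in lt_xy.
  exists r; rewrite -zr; split=> //; first exact: connect_dedge_le zy.
  apply: connect_sub zy => u v uv; apply: connect1.
  by rewrite root_edgeE uv.
by have := connect_dedge_le yx; lia.
Qed.

Lemma root_edge_connect A r : r \in A -> connect (root_edge A) (lo r) (hi r).
Proof.
move=> Ar; apply: connect1; rewrite root_edgeE; apply/orP; left.
by apply/dedgeP; exists r.
Qed.

Definition diagram_of A : {set 'I_n * 'I_n} := [set val r | r in A].

Lemma mem_diagram_of A x y :
  reflect (exists2 r, r \in A & lo r = x /\ hi r = y) ((x, y) \in diagram_of A).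
Proof.
apply: (iffP imsetP) => [[r Ar]|[r Ar [<- <-]]]; last first.
  by exists r => //; rewrite root_lo_hi.
by rewrite root_lo_hi => -[-> ->]; exists r.
Qed.

Lemma NN_partitionP A : partition (NN_partition A) [set: 'I_n].
Proof. by apply: equivalence_partitionP => x y z _ _ _; apply: root_edge_equiv. Qed.

(** The blocks are increasing chains, and consecutive elements of such a chain are the two ends of
    one root. *)
Lemma arcs_NN_partition A :
    {in A &, injective (@lo n)} -> {in A &, injective (@hi n)} ->
  arcs (NN_partition A) = diagram_of A.
Proof.
move=> lo_inj hi_inj; apply/setP=> -[x y]; rewrite inE /=.
apply/andP/mem_diagram_of => [[lt_xy]|[r Ar [<- <-]]].
  case/exists_inP=> B /imsetP[w _ ->]; rewrite !inE /= => /and3P[wx wy].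
  move/forall_inP=> nb; have xy : connect (root_edge A) x y.
    by apply: connect_trans wy; rewrite root_edge_sym.
  have [r [Ar rx le_ry ry]] := connect_next lo_inj hi_inj xy lt_xy.
  exists r => //; split=> //; apply: val_inj => /=.
  have := nb (hi r); rewrite !inE /= (connect_trans wy) 1?root_edge_sym //.
  by move/(_ isT); have := lo_lt_hi r; rewrite rx; lia.
split; first exact: lo_lt_hi.
apply/exists_inP; exists [set y in setT | connect (root_edge A) (lo r) y].
  exact: imset_f.
rewrite !inE /= connect0 root_edge_connect //=.
apply/forall_inP=> z; rewrite !inE /= => rz; apply/negP=> /andP[lt_rz lt_zr].
(* A block element above [lo r] is at or beyond the upper end of the arc opening at [lo r], and that
   arc is [r]. *)
have [q [Aq Elo le_qz _]] := connect_next lo_inj hi_inj rz lt_rz.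
by have Eq := lo_inj _ _ Aq Ar Elo; move: le_qz; rewrite Eq; lia.
Qed.

Lemma porbit_step (T : finType) (s : {perm T}) (x : T) : s x \in porbit s x.
Proof. by rewrite -[s]expg1 mem_porbit. Qed.

Lemma porbit_sub (T : finType) (e : rel T) (s : {perm T}) (x y : T) :
  (forall z : T, connect e z (s z)) -> y \in porbit s x -> connect e x y.
Proof.
move=> es /porbitP[i ->]; elim: i => [|i IH]; first by rewrite perm1 connect0.
by apply: connect_trans IH _; rewrite expgSr permM.
Qed.

Lemma porbit_trans (T : finType) (s : {perm T}) (y x z : T) :
  y \in porbit s x -> z \in porbit s y -> z \in porbit s x.
Proof. by rewrite -!eq_porbit_mem => /eqP <-. Qed.

(** Multiplying by a transposition of points from different orbits fuses these orbits; that [a] and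
    [b] end up together follows by counting orbits. *)
Lemma porbit_tperm_merge (T : finType) (s : {perm T}) (a b : T) (u := (s * tperm a b)%g) :
    a \notin porbit s b ->
  a \in porbit u b /\ (forall x y : T, y \in porbit s x -> y \in porbit u x).
Proof.
move=> nab; have ab: a != b by apply: contraNneq nab => ->; exact: porbit_id.
(* The counting lemma has the transposition on the left, hence the passage to inverses, which have
   the same orbits. *)
have Hu := porbits_mul_tperm s^-1 a b; rewrite /= porbitV nab ab porbitsV in Hu.
have Eu : (tperm a b * s^-1 = u^-1)%g by rewrite /u invMg tpermV.
rewrite Eu porbitsV in Hu.
have Hs := porbits_mul_tperm u^-1 a b; rewrite /= porbitV ab porbitsV in Hs.
rewrite -Eu mulgA tperm2 mul1g porbitsV in Hs.
(* Otherwise each of [s] and [u] would have one orbit fewer than the other. *)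
have uab : a \in porbit u b by apply/negPn/negP => nu; rewrite nu in Hs; lia.
split=> // x y; rewrite porbit_sym => /porbitP[i ->] {x}.
elim: i => [|i IH]; first by rewrite perm1 porbit_id.
rewrite porbit_sym; apply: porbit_trans (_ : (s ^+ i)%g y \in _) _.
  by rewrite porbit_sym.
rewrite expgSr permM; set z := (s ^+ i)%g y.
have uz := porbit_step u z; move: uz; rewrite {1}/u permM.
(* [u z] and [s z] differ at most by exchanging [a] and [b], which share an orbit of [u]. *)
case: tpermP => [->|->|_ _ //] uz; apply: porbit_trans uz _ => //.
by rewrite porbit_sym.
Qed.

Lemma map_uniq_inj (T1 T2 : eqType) (h : T1 -> T2) (s : seq T1) :
  uniq (map h s) -> {in s &, injective h}.
Proof.
elim: s => //= a s IH /andP[na us] x y.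
rewrite !inE => /orP[/eqP->|sx] /orP[/eqP->|sy] Exy //; last exact: IH.
  by rewrite Exy map_f in na.
by rewrite -Exy map_f in na.
Qed.

(** Induction on [g]: each new transposition fuses two distinct orbits of the product so far, just
    as its arc joins two components of the graph. *)
Lemma porbit_pprod (g : seq (posroot n)) x y :
    uniq (map (@lo n) g) -> uniq (map (@hi n) g) ->
  (y \in porbit (pprod (map (@transp n) g)) x)
     = connect (root_edge [set r in g]) x y.
Proof.
elim: g x y => [|r g IH] x y.
  move=> _ _; apply/idP/idP.
    by apply: porbit_sub => z; rewrite perm1 connect0.
  case/connect_first=> [->|[z]]; first exact: porbit_id.
  by rewrite root_edgeE => /orP[] /dedgeP[r]; rewrite inE.
rewrite !map_cons !cons_uniq => /andP[nlo ulo] /andP[nhi uhi].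
have {}IH x' y' := IH x' y' ulo uhi.
have lo_inj := map_uniq_inj ulo; have hi_inj := map_uniq_inj uhi.
have lo_inj' : {in [set r in g] &, injective (@lo n)}.
  by move=> p q; rewrite !inE; apply: lo_inj.
have hi_inj' : {in [set r in g] &, injective (@hi n)}.
  by move=> p q; rewrite !inE; apply: hi_inj.
rewrite [pprod _]/= {1}/pcomp; set s := pprod _ in IH *.
(* The lower end of [r] is no lower end in [g], so it is the top of its
   component; likewise the upper end is the bottom of its own. *)
have nc : lo r \notin porbit s (hi r).
  rewrite porbit_sym IH; apply/negP=> /(connect_next lo_inj' hi_inj').
  move=> /(_ (lo_lt_hi r))[q []]; rewrite inE => gq Eq _ _.
  by case/negP: nlo; rewrite -Eq map_f.
have [] := porbit_tperm_merge nc; rewrite -/(transp r); set u := (s * _)%g.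
move=> rr su; have sub : subrel (connect (root_edge [set r in g]))
                                (connect (root_edge [set q in r :: g])).
  apply: connect_sub => {}x {}y; rewrite root_edgeE => xy; apply: connect1.
  rewrite root_edgeE; case/orP: xy => /dedgeP[q]; rewrite inE => gq [-> ->].
    by apply/orP; left; apply/dedgeP; exists q; rewrite // !inE gq orbT.
  by apply/orP; right; apply/dedgeP; exists q; rewrite // !inE gq orbT.
have er : connect (root_edge [set q in r :: g]) (lo r) (hi r).
  by apply: root_edge_connect; rewrite !inE eqxx.
(* A step of [u] is a step of [s], possibly followed by a move along [r]; conversely, the ends of
   every edge share an orbit of [u]. *)
apply/idP/idP.
  apply: porbit_sub => z; rewrite permM.
  have sz : connect (root_edge [set q in r :: g]) z (s z).
    by apply: sub; rewrite -IH porbit_step.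
  apply: connect_trans sz _; rewrite /transp; case: tpermP => [->|->|_ _] //.
  by rewrite root_edge_sym.
case/connectP=> p; elim: p x => [|z p IHp] x /= => [_ ->|/andP[xz pz] Dy].
  exact: porbit_id.
apply: porbit_trans (IHp z pz Dy).
suff dz v w : dedge [set q in r :: g] v w -> w \in porbit u v.
  move: xz; rewrite root_edgeE => /orP[/dz //|/dz].
  by rewrite porbit_sym.
case/dedgeP=> q; rewrite !inE => /orP[/eqP->|gq] [-> ->].
  by rewrite porbit_sym.
by apply: su; rewrite IH root_edge_connect ?inE.
Qed.

Lemma porbits_pprod (g : seq (posroot n)) :
    uniq (map (@lo n) g) -> uniq (map (@hi n) g) ->
  porbits (pprod (map (@transp n) g)) = NN_partition [set r in g].
Proof.
move=> ulo uhi; apply/setP=> B.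
apply/imsetP/imsetP => -[x _ ->]; exists x => //; apply/setP=> y.
  by rewrite porbit_pprod // inE in_setT.
by rewrite porbit_pprod // inE in_setT.
Qed.
End Chains.

(** * Partitions, their arcs, and uncrossing *)

Section Partitions.
Variable n : nat.
Local Notation partn := {set {set 'I_n}}.
Local Notation diagram := {set 'I_n * 'I_n}.
Implicit Types (P Q : partn) (D E : diagram) (x y z a b c d : 'I_n).

Lemma block_next (B : {set 'I_n}) x y : x \in B -> y \in B -> x < y ->
  exists z, [/\ z \in B, x < z <= y & {in B, forall k : 'I_n, ~~ (x < k < z)}].
Proof.
move=> Bx By xy; pose F k := (k \in B) && (x < k).
have Fy : F y by rewrite /F By.
case: (arg_minnP (fun k : 'I_n => val k) Fy) => z /andP[Bz xz] zmin; exists z.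
split=> //; first by rewrite xz zmin.
move=> k Bk; apply/negP=> /andP[xk kz].
by have := zmin k; rewrite /F Bk xk /= => /(_ isT); lia.
Qed.

Lemma block_prev (B : {set 'I_n}) x y : x \in B -> x < y ->
  exists z, [/\ z \in B, x <= z < y & {in B, forall k : 'I_n, ~~ (z < k < y)}].
Proof.
move=> Bx xy; pose F k := (k \in B) && (k < y).
have Fx : F x by rewrite /F Bx.
case: (arg_maxnP (fun k : 'I_n => val k) Fx) => z /andP[Bz zy] zmax; exists z.
split=> //; first by rewrite zy andbT; exact: zmax.
move=> k Bk; apply/negP=> /andP[zk ky].
by have := zmax k; rewrite /F Bk ky /= => /(_ isT); lia.
Qed.

Lemma mem_arcs P x y (B : {set 'I_n}) : B \in P -> x \in B -> y \in B ->
  x < y -> {in B, forall k : 'I_n, ~~ (x < k < y)} -> (x, y) \in arcs P.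
Proof.
move=> PB Bx By xy nk; rewrite inE /= xy; apply/exists_inP; exists B => //.
by rewrite Bx By; apply/forall_inP.
Qed.

Lemma arcs_block P x y : (x, y) \in arcs P ->
  exists B, [/\ B \in P, x \in B & y \in B].
Proof.
by rewrite inE => /andP[_ /exists_inP[B PB /and3P[Bx By _]]]; exists B.
Qed.

Lemma crossing_freeP D :
  reflect (forall a b c d, ~~ crossing D a b c d) (crossing_free D).
Proof.
apply: (iffP idP) => [nc a b c d|nc].
  apply: contra nc => abcd; apply/existsP; exists a; apply/existsP; exists b.
  by apply/existsP; exists c; apply/existsP; exists d.
apply/negP=> /existsP[a /existsP[b /existsP[c /existsP[d]]]].
exact/negP/nc.
Qed.

(** Crossing blocks contain crossing arcs: take [a'] last in [B] before [b], then [c'] next after it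
    in [B], then [b'] last in [C] before [c'], and [d'] next after it in [C]. *)
Lemma crossing_free_NC P : partition P [set: 'I_n] -> crossing_free (arcs P) ->
  NC P.
Proof.
move=> pP /crossing_freeP nc; split=> // B C a b c d PB PC ab bc cd Ba Bc Cb Cd.
have [_ tiP _] := and3P pP; apply: contraTeq isT => neBC.
have dBC x : x \in B -> x \in C -> False.
  move=> Bx Cx; have := disjoint_setI0 (trivIsetP tiP _ _ PB PC neBC).
  by move/setP/(_ x); rewrite !inE Bx Cx.
have [a' [Ba' /andP[_ a'b] a'n]] := block_prev Ba ab.
have [c' [Bc' /andP[a'c' _] c'n]] := block_next Ba' Bc (ltn_trans a'b bc).
have bc' : b < c'.
  have := a'n c' Bc'; rewrite a'c' -leqNgt leq_eqVlt => /orP[/eqP/val_inj Ebc|//].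
  by case: (dBC b) => //; rewrite Ebc.
have [b' [Cb' /andP[bb' b'c'] b'n]] := block_prev Cb bc'.
have c'c : c' <= c.
  by have := c'n c Bc; rewrite (ltn_trans a'b bc) -leqNgt.
have b'd := ltn_trans b'c' (leq_ltn_trans c'c cd).
have [d' [Cd' /andP[b'd' _] d'n]] := block_next Cb' Cd b'd.
have c'd' : c' < d'.
  have := b'n d' Cd'; rewrite b'd' -leqNgt leq_eqVlt => /orP[/eqP/val_inj Ecd|//].
  by case: (dBC c') => //; rewrite Ecd.
case/negP: (nc a' b' c' d'); rewrite /crossing (leq_trans a'b bb') b'c' c'd'.
by rewrite (mem_arcs PB Ba' Bc') ?(mem_arcs PC Cb' Cd').
Qed.

(** Going from an element of a block to the next one follows an arc, and an arc of [Q] stays in one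
    block of [Q]; the induction is on the distance from [x] to [y]. *)
Lemma same_block_arcs P Q x y :
    partition P [set: 'I_n] -> partition Q [set: 'I_n] -> arcs P = arcs Q ->
  y \in pblock P x -> y \in pblock Q x.
Proof.
move=> pP pQ Epq.
have [[/eqP cP tP _] [/eqP cQ tQ _]] := (and3P pP, and3P pQ).
have inP z : z \in pblock P z by rewrite mem_pblock cP.
have inQ z : z \in pblock Q z by rewrite mem_pblock cQ.
have symP z w : (z \in pblock P w) = (w \in pblock P z).
  by rewrite -!eq_pblock ?cP ?inE // eq_sym.
have symQ z w : (z \in pblock Q w) = (w \in pblock Q z).
  by rewrite -!eq_pblock ?cQ ?inE // eq_sym.
wlog: x y / x < y => [W xy|xy].
  case: (ltngtP x y) => [lt_xy|lt_yx|/val_inj->//]; first exact: W.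
  by rewrite symQ W // symP.
have [k] := ubnP (y - x); elim: k x xy => // k IH x xy lt_k Pxy.
have [z [Pz /andP[xz zy] nz]] := block_next (inP x) Pxy xy.
have PPx : pblock P x \in P by rewrite pblock_mem // cP.
have : (x, z) \in arcs Q by rewrite -Epq (mem_arcs PPx).
case/arcs_block=> B [QB Bx Bz].
have EB := def_pblock tQ QB Bx.
have Qz : z \in pblock Q x by rewrite EB.
have [zlt|zge] := ltnP z y; last first.
  by have -> : y = z by apply/val_inj/eqP; rewrite /= eqn_leq zge zy.
have : y \in pblock Q z.
  apply: IH => //; first by clear -lt_k xz zy; lia.
  by rewrite (same_pblock tP Pz).
by rewrite (same_pblock tQ Qz).
Qed.

Lemma arcs_inj P Q : partition P [set: 'I_n] -> partition Q [set: 'I_n] ->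
  arcs P = arcs Q -> P = Q.
Proof.
move=> pP pQ Epq.
rewrite -(equivalence_partition_pblock pP) -(equivalence_partition_pblock pQ).
apply: eq_imset => x; apply/setP=> y; rewrite !inE /=.
by apply/idP/idP; apply: same_block_arcs.
Qed.

(** * Crossing-free diagrams with prescribed ends *)

Definition arc_diagram D : Prop :=
  [/\ {in D, forall p : 'I_n * 'I_n, p.1 < p.2}, {in D &, injective fst}
    & {in D &, injective snd}].

Definition openers D : {set 'I_n} := [set p.1 | p in D].
Definition closers D : {set 'I_n} := [set p.2 | p in D].

(** If [c] came before [c'], consider the arc [(b, c)] of [E]. For [b] after [a] it is also in [D],
    where [c] already closes the arc from [a]; for [b] before [a] it crosses [(a, c')]; for [b]
    equal to [a] it clashes with [(a, c')]. *)
Lemma crossing_free_agree D E a c c' :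
    arc_diagram D -> arc_diagram E -> closers D = closers E ->
    crossing_free E ->
    (forall x y, a < x -> (x, y) \in E -> (x, y) \in D) ->
  (a, c) \in D -> (a, c') \in E -> c' <= c.
Proof.
move=> [ltD fD sD] [ltE fE sE] Ecl /crossing_freeP ncE agree Dac Eac'.
rewrite leqNgt; apply/negP=> cc'.
have : c \in closers E by rewrite -Ecl; apply: imset_f Dac.
case/imsetP=> -[b c0] Ebc /= Ec; rewrite -{c0}Ec in Ebc.
case: (ltngtP a b) => [ab|ba|/val_inj Eab].
- have [Eba] := sD _ _ (agree _ _ ab Ebc) Dac erefl.
  by move: ab; rewrite Eba; lia.
- case/negP: (ncE b a c c'); rewrite /crossing ba cc' Ebc Eac' /= andbT.
  exact: (ltD _ Dac).
- rewrite -Eab in Ebc; have [Ecc] := fE _ _ Ebc Eac' erefl.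
  by move: cc'; rewrite Ecc; lia.
Qed.

(** Openers are matched from right to left: once all arcs opening after [a] agree, the partner of
    [a] is bounded both ways by [crossing_free_agree]. *)
Lemma crossing_free_unique D E :
    arc_diagram D -> arc_diagram E -> openers D = openers E ->
    closers D = closers E -> crossing_free D -> crossing_free E ->
  D = E.
Proof.
move=> vD vE Eop Ecl cD cE.
suff H a : forall y, ((a, y) \in D) = ((a, y) \in E).
  by apply/setP=> -[x y]; exact: H.
have [k] := ubnP (n - a); elim: k a => // k IH a lt_k.
have agree x y : a < x -> ((x, y) \in D) = ((x, y) \in E).
  by move=> ax; apply: IH; have := ltn_ord x; lia.
have main c c' : (a, c) \in D -> (a, c') \in E -> c = c'.
  move=> Dac Eac; apply: val_inj; apply/eqP; rewrite /= eqn_leq; apply/andP.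
  split.
    apply: (crossing_free_agree vE vD) Eac Dac => //.
    by move=> x y ax; rewrite agree.
  apply: (crossing_free_agree vD vE) Dac Eac => //.
  by move=> x y ax; rewrite agree.
move=> y; apply/idP/idP=> Hy.
  have : a \in openers E by rewrite -Eop; apply: imset_f Hy.
  case/imsetP=> -[a' c] Eac /= Ea; rewrite -Ea in Eac.
  by rewrite (main _ _ Hy Eac).
have : a \in openers D by rewrite Eop; apply: imset_f Hy.
case/imsetP=> -[a' c] Dac /= Ea; rewrite -Ea in Dac.
by rewrite -(main _ _ Dac Hy).
Qed.

(* Uncrossing a < b < c < d lowers the weight by (b - a) * (d - c). *)
Definition weight D : nat := \sum_(p in D) p.1 * p.2.

(** The new arcs reuse the openers [a], [b] and the closers [c], [d] of the removed ones, so no end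
    is gained, lost or used twice in the same role. *)
Lemma uncross_step D E : arc_diagram D -> uncross D E ->
  [/\ arc_diagram E, openers E = openers D, closers E = closers D
    & weight E < weight D].
Proof.
move=> [ltD fD sD].
case/existsP=> a /existsP[b /existsP[c /existsP[d /andP[cr /eqP Ee]]]].
case/and5P: cr => ab bc cd Dac Dbd.
have memE p : (p \in E) = [|| p == (a, d), p == (b, c)
                           | [&& p != (a, c), p != (b, d) & p \in D]].
  by rewrite Ee !inE negb_or -!orbA -andbA.
have neqF (x y : 'I_n) : x < y -> x = y -> False by move=> + Exy; rewrite Exy ltnn.
have ac := ltn_trans ab bc.
split.
- split=> [p|p q|p q]; rewrite !memE.
  + by case/or3P=> [/eqP->|/eqP->|/and3P[_ _ /ltD]] //=; lia.
  + case/or3P=> [/eqP->|/eqP->|/and3P[pac pbd Dp]];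
    case/or3P=> [/eqP->|/eqP->|/and3P[qac qbd Dq]] //= Epq.
    * by case: (neqF _ _ ab).
    * by case/eqP: qac; apply: fD.
    * by case: (neqF _ _ ab).
    * by case/eqP: qbd; apply: fD.
    * by case/eqP: pac; apply: fD.
    * by case/eqP: pbd; apply: fD.
    * exact: fD.
  + case/or3P=> [/eqP->|/eqP->|/and3P[pac pbd Dp]];
    case/or3P=> [/eqP->|/eqP->|/and3P[qac qbd Dq]] //= Epq.
    * by case: (neqF _ _ cd).
    * by case/eqP: qbd; apply: sD.
    * by case: (neqF _ _ cd).
    * by case/eqP: qac; apply: sD.
    * by case/eqP: pbd; apply: sD.
    * by case/eqP: pac; apply: sD.
    * exact: sD.
- apply/setP=> x; apply/imsetP/imsetP => -[p].
    rewrite memE => /or3P[/eqP->|/eqP->|/and3P[_ _ Dp]] ->.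
    + by exists (a, c).
    + by exists (b, d).
    + by exists p.
  move=> Dp ->; have [->|pac] := eqVneq p (a, c).
    by exists (a, d); rewrite // memE eqxx.
  have [->|pbd] := eqVneq p (b, d).
    by exists (b, c); rewrite // memE eqxx orbT.
  by exists p; rewrite // memE pac pbd Dp !orbT.
- apply/setP=> x; apply/imsetP/imsetP => -[p].
    rewrite memE => /or3P[/eqP->|/eqP->|/and3P[_ _ Dp]] ->.
    + by exists (b, d).
    + by exists (a, c).
    + by exists p.
  move=> Dp ->; have [->|pac] := eqVneq p (a, c).
    by exists (b, c); rewrite // memE eqxx orbT.
  have [->|pbd] := eqVneq p (b, d).
    by exists (a, d); rewrite // memE eqxx.
  by exists p; rewrite // memE pac pbd Dp !orbT.
(* Only one arc of [D] opens at [a] and only one at [b], so the new arcs are not yet in [D] and each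
   adds its own term to the weight. *)
have nad : (a, d) \notin D.
  by apply/negP=> Dad; have [/esym/neqF] := fD _ _ Dad Dac erefl; apply.
have nbc : (b, c) \notin D.
  by apply/negP=> Dbc; have [/neqF] := fD _ _ Dbc Dbd erefl; apply.
have nab : (a, c) != (b, d) by apply/eqP=> -[Eab _]; exact: neqF ab Eab.
rewrite /weight Ee -setUA big_setU1 /=; last first.
  by rewrite !inE (negPf nad) andbF orbF xpair_eqE
    (ltn_eqF ab : (a == b) = false).
rewrite big_setU1 /= ?inE ?negb_or ?(negPf nbc) ?andbF //.
have Dbd' : (b, d) \in D :\ (a, c) by rewrite !inE eq_sym nab.
rewrite [X in _ < X](big_setD1 (a, c) Dac) /= (big_setD1 (b, d) Dbd') /=.
by rewrite setDDl !addnA ltn_add2r; clear -ab cd; nia.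
Qed.

Lemma uncross_outcome D : arc_diagram D ->
  exists2 E, outcome D E
    & [/\ arc_diagram E, openers E = openers D & closers E = closers D].
Proof.
have [k] := ubnP (weight D); elim: k D => // k IH D lt_k vD.
have [cf|] := boolP (crossing_free D).
  by exists D; rewrite // /outcome connect0.
rewrite negbK => /existsP[a /existsP[b /existsP[c /existsP[d cr]]]].
pose D' := [set (a, d); (b, c)] :|: (D :\: [set (a, c); (b, d)]).
have DD' : uncross D D'.
  apply/existsP; exists a; apply/existsP; exists b; apply/existsP; exists c.
  by apply/existsP; exists d; rewrite cr eqxx.
have [vD' oD' cD' wD'] := uncross_step vD DD'.
have [|E /andP[conE cfE] [vE oE cE]] := IH D' _ vD'; first by lia.
exists E; last by rewrite oE cE.
by rewrite /outcome cfE (connect_trans (connect1 DD') conE).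
Qed.

Lemma uncross_connect D E : arc_diagram D -> connect (@uncross n) D E ->
  [/\ arc_diagram E, openers E = openers D & closers E = closers D].
Proof.
move=> vD /connectP[p]; elim: p D vD => [|D' p IH] D vD /=; first by move=> _ ->.
case/andP=> /(uncross_step vD)[vD' oD' cD' _] /(IH _ vD')H /H[].
by rewrite oD' cD'.
Qed.

(** Every outcome is crossing-free with the same ends as [arcs P], hence equals [arcs Q];
    termination provides an outcome, so [arcs Q] is one. *)
Lemma L_mapE P Q : partition Q [set: 'I_n] ->
    arc_diagram (arcs P) -> arc_diagram (arcs Q) ->
    openers (arcs Q) = openers (arcs P) -> closers (arcs Q) = closers (arcs P) ->
    crossing_free (arcs Q) ->
  L_map P = Q.
Proof.
move=> pQ vP vQ oQ cQ cfQ.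
have outcomeE D : outcome (arcs P) D -> D = arcs Q.
  case/andP=> /(uncross_connect vP)[vD oD cD] cfD.
  by apply: crossing_free_unique; rewrite ?oD ?cD.
have outQ : outcome (arcs P) (arcs Q).
  by have [E oE _] := uncross_outcome vP; rewrite -(outcomeE E oE).
have LQ : is_L_image P Q.
  rewrite /is_L_image pQ; apply/forallP=> D; apply/eqP.
  by apply/idP/eqP=> [/outcomeE|->].
(* The chosen [Q'] could differ from [Q] a priori, but [arcs Q'] is an outcome as well, and arcs
   determine the partition. *)
rewrite /L_map; case: pickP => [Q' /andP[pQ' /forallP LQ']|/(_ Q)]; last first.
  by rewrite LQ.
apply: arcs_inj => //; apply: outcomeE.
by rewrite (eqP (LQ' (arcs Q'))).
Qed.

End Partitions.

(** * Sets of roots as arc diagrams *)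

Section Diagrams.
Variable n : nat.
Implicit Types (A G : {set posroot n}) (g : seq (posroot n)).

Lemma diagram_of_arc A :
    {in A &, injective (@lo n)} -> {in A &, injective (@hi n)} ->
  arc_diagram (diagram_of A).
Proof.
move=> lo_inj hi_inj; split.
- by move=> _ /imsetP[r _ ->]; exact: lo_lt_hi.
- by move=> _ _ /imsetP[r Ar ->] /imsetP[q Aq ->] /lo_inj->.
- by move=> _ _ /imsetP[r Ar ->] /imsetP[q Aq ->] /hi_inj->.
Qed.

Lemma openers_diagram A : openers (diagram_of A) = [set lo r | r in A].
Proof. by rewrite /openers -imset_comp. Qed.

Lemma closers_diagram A : closers (diagram_of A) = [set hi r | r in A].
Proof. by rewrite /closers -imset_comp. Qed.

Lemma noncrossing_diagram g :
  noncrossing g -> crossing_free (diagram_of [set r in g]).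
Proof.
move=> nc; apply/crossing_freeP=> a b c d; apply/negP.
case/and5P=> ab bc cd /mem_diagram_of[p gp [Ea Ec]] /mem_diagram_of[q gq [Eb Ed]].
rewrite !inE in gp gq.
by have := nc p q gp gq; rewrite Ea Eb Ec Ed ab bc cd.
Qed.

End Diagrams.

(** * Comparison of f with the L-map *)

Theorem theorem3p5 (n : nat) (n_gt0 : 0 < n) (A : {set posroot n}) (hA : NN A) :
  NC (porbits (f_map A)) /\ porbits (f_map A) = L_map (NN_partition A).
Proof.
have shA a b : a \in A -> b \in A -> a != b -> shifted a b || shifted b a.
  exact: NN_shifted.
have lo_inj : {in A &, injective (@lo n)}.
  move=> a b Aa Ab Eab; apply: contraTeq isT => /(shA a b Aa Ab).
  by rewrite /shifted Eab !ltnn.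
have hi_inj : {in A &, injective (@hi n)}.
  move=> a b Aa Ab Eab; apply: contraTeq isT => /(shA a b Aa Ab).
  by rewrite /shifted Eab !ltnn !andbF.
rewrite /f_map; set le_hi := fun a b : posroot n => _; set s := sort _ _.
have memA a : (a \in s) = (a \in A) by rewrite mem_sort mem_enum.
have us : uniq s by rewrite sort_uniq enum_uniq.
(* Any two distinct roots of the antichain are shifted one way or the other, and the order of the
   upper ends selects the direction. *)
have so_s : sorted (@shifted n) s.
  have : sorted le_hi s by apply: sort_sorted => a b; exact: leq_total.
  have : {in s &, forall a b, a != b -> shifted a b || shifted b a}.
    by move=> a b; rewrite !memA; apply: shA.
  clear -us; elim: s us => // a s IH; case: s IH => // b s IH.
  case/andP=> nas us sh /andP[ab so] /=.
  apply/andP; split; last first.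
    by apply: IH => // x y sx sy; apply: sh; rewrite inE ?sx ?sy orbT.
  have := sh a b; rewrite !inE !eqxx orbT => /(_ isT isT).
  case: eqVneq nas => [->|_ _ /(_ isT)]; first by rewrite inE eqxx.
  by move: ab; rewrite /le_hi /shifted; lia.
have [g [-> nc_g lo_g hi_g]] := f_seq_repairs so_s.
have ulo : uniq (map (@lo n) g).
  rewrite (perm_uniq lo_g) map_inj_in_uniq // => a b.
  by rewrite !memA; apply: lo_inj.
have uhi : uniq (map (@hi n) g).
  rewrite (perm_uniq hi_g) map_inj_in_uniq // => a b.
  by rewrite !memA; apply: hi_inj.
(* From here on f enters only through the rematched arcs [G], whose chains are its cycles. *)
rewrite (porbits_pprod ulo uhi); set G := [set r in g].
have lo_inj' : {in G &, injective (@lo n)}.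
  by move=> p q; rewrite !inE; apply: map_uniq_inj ulo p q.
have hi_inj' : {in G &, injective (@hi n)}.
  by move=> p q; rewrite !inE; apply: map_uniq_inj uhi p q.
have pG := NN_partitionP G.
have aG := arcs_NN_partition lo_inj' hi_inj'.
have aA := arcs_NN_partition lo_inj hi_inj.
have cfG : crossing_free (arcs (NN_partition G)).
  by rewrite aG; exact: noncrossing_diagram.
(* [G] and [A] share their lower ends and their upper ends, the data that uncrossing preserves. *)
have img (h : posroot n -> 'I_n) : perm_eq (map h g) (map h s) ->
    [set h r | r in G] = [set h r | r in A].
  move/perm_mem=> Eh; apply/setP=> x; have := Eh x.
  move=> {}Eh; apply/imsetP/imsetP=> -[r].
    rewrite inE => gr Ex; move: Eh; rewrite Ex map_f // => /esym/mapP[q sq Eq].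
    by exists q; rewrite // -memA.
  rewrite -memA => sr Ex; move: Eh; rewrite Ex (map_f h sr) => /mapP[q gq Eq].
  by exists q; rewrite // inE.
split; first exact: crossing_free_NC.
apply/esym/L_mapE; rewrite ?aG ?aA //.
- exact: diagram_of_arc.
- exact: diagram_of_arc.
- by rewrite !openers_diagram img.
- by rewrite !closers_diagram img.
- by rewrite -aG.
Qed.
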